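(* Let $\mathbf{M}=(M_0,M_1,\ldots,M_k)$, $M_i\in\mathbb{R}^{n\times n}$, have the row $\mathcal{W}$-property, let $\mathbf{q}=(q_0,\ldots,q_k)$ with $q_i\in\mathbb{R}^n$, and let the perturbations $\Delta M_i\in\mathbb{R}^{n\times n}$ and $\Delta q_i\in\mathbb{R}^n$ satisfy $|\Delta M_i|\le\epsilon_i|M_i|$ and $|\Delta q_i|\le\epsilon_i|(-q_i)_+|$ (entrywise), respectively, where $\epsilon_i\ge 0$, $i=0,1,\ldots,k$. Let each $M_i=\Lambda_i-C_i$ be an $H_+$-matrix, where $\Lambda_i$ is the diagonal part of $M_i$, and suppose $\rho(\max_{0\le i\le k}\{\Lambda_i^{-1}|C_i|\})<1$. Let $$\gamma_\ell=\Big(I-\max_{0\le i\le k}\{\Lambda_i^{-1}|C_i|\}\Big)^{-1}\Lambda_\ell^{-1},\qquad \ell=0,1,\ldots,k.$$ If the $\epsilon_i$ are small enough that $$\hat\eta:=\sum_{i=0}^k\epsilon_i\|\gamma_i\|_\infty\|M_i\|_\infty<1,$$ then: (i) $\tilde{\mathbf{M}}=(M_0+\Delta M_0,M_1+\Delta M_1,\ldots,M_k+\Delta M_k)$ has the row $\mathcal{W}$-property. (ii) Let $x$ and $y$ be the solutions of EVLCP $(\mathbf{M},\mathbf{q})$ and EVLCP $(\tilde{\mathbf{M}},\tilde{\mathbf{q}})$, respectively, where $\tilde{\mathbf{q}}=(q_0+\Delta q_0,\ldots,q_k+\Delta q_k)$. Then $$\frac{\|x-y\|_\infty}{\|x\|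_\infty}\le\frac{2\big(\epsilon_0\|\gamma_0|M_0|\|_\infty+\cdots+\epsilon_k\|\gamma_k|M_k|\|_\infty\big)}{1-\hat\eta}.$$
   Context: EVLCP $(\mathbf{M},\mathbf{q})$, for $\mathbf{M}=(M_0,\ldots,M_k)$ with $M_i\in\mathbb{R}^{n\times n}$ and $\mathbf{q}=(q_0,\ldots,q_k)$ with $q_i\in\mathbb{R}^n$, is the problem of finding $x\in\mathbb{R}^n$ with $\min\{M_0x+q_0,M_1x+q_1,\ldots,M_kx+q_k\}=0$, where $\min$ is the componentwise minimum. $\mathbf{M}$ has the row $\mathcal{W}$-property if $\min(M_0x,\ldots,M_kx)\le 0\le \max(M_0x,\ldots,M_kx)$ (componentwise min, max and inequalities) implies $x=0$; in that case EVLCP $(\mathbf{M},\mathbf{q})$ has a unique solution for every $\mathbf{q}$. $|A|$ is the entrywise absolute value of a matrix or vector; $\max_{0\le i\le k}\{A_i\}$ is the entrywise maximum of matrices; $\rho$ is the spectral radius; $q_+=\max\{0,q\}$ componentwise. A matrix $A$ is an $M$-matrix if $A^{-1}\ge 0$ entrywise and $a_{ij}\le 0$ for $i\ne j$; an $H$-matrix if its comparison matrix $\langle A\rangle$ (entries $|a_{ii}|$ on the diagonal, $-|a_{ij}|$ off the diagonal) is an $M$-matrix; an $H_+$-matrix if it is an $H$-matrix with positive diagonal entries. $\|\cdot\|_\infty$ is the vector $\infty$-norm and its induced matrix norm. *)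

(* Defs.v *)
From HB Require Import structures.
From mathcomp Require Import all_boot all_order all_algebra.
From mathcomp Require Import complex.
From mathcomp Require Import all_classical all_reals all_analysis.

Set Implicit Arguments.
Unset Strict Implicit.
Unset Printing Implicit Defensive.

Import Order.TTheory GRing.Theory Num.Theory.
Import numFieldNormedType.Exports.

Local Open Scope classical_set_scope.
Local Open Scope ring_scope.

(* Entrywise operations. The norm `|A| of a matrix is, in the library,
   max_(i,j) |A i j|; on column vectors this is the infinity-norm, but it is
   neither the entrywise absolute value (mxabs) nor the induced norm (opnorm). *)

Definition mxle {R : realType} {m n : nat} (A B : 'M[R]_(m, n)) : Prop :=
  forall i j, A i j <= B i j.

Definition mxabs {R : realType} {m n : nat} (A : 'M[R]_(m, n)) : 'M[R]_(m, n) :=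
  map_mx (fun t => `|t|) A.

Definition mxpos {R : realType} {m n : nat} (A : 'M[R]_(m, n)) : 'M[R]_(m, n) :=
  map_mx (fun t => Num.max 0 t) A.

(* The family is nonempty, so folding from its 0-th member adds nothing. *)
Definition mxmin {R : realType} {k m n : nat} (A : 'I_k.+1 -> 'M[R]_(m, n)) :
    'M[R]_(m, n) :=
  \matrix_(a, b) \big[Num.min/A ord0 a b]_(i < k.+1) A i a b.

Definition mxmax {R : realType} {k m n : nat} (A : 'I_k.+1 -> 'M[R]_(m, n)) :
    'M[R]_(m, n) :=
  \matrix_(a, b) \big[Num.max/A ord0 a b]_(i < k.+1) A i a b.

Definition opnorm {R : realType} {n : nat} (A : 'M[R]_n) : R :=
  sup [set `|A *m x| | x in [set x : 'cV[R]_n | `|x| <= 1]].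

(* Eigenvalues are taken over the complex numbers R[i]. *)
Definition spectral_radius {R : realType} {n : nat} (A : 'M[R]_n) : R :=
  sup [set ComplexField.Normc.normc z |
         z in [set z : R[i] | eigenvalue (map_mx (real_complex R) A) z]].

Definition evlcp_sol {R : realType} {k n : nat} (M : 'I_k.+1 -> 'M[R]_n)
    (q : 'I_k.+1 -> 'cV[R]_n) (x : 'cV[R]_n) : Prop :=
  mxmin (fun i => M i *m x + q i) = 0.

Definition row_W_property {R : realType} {k n : nat}
    (M : 'I_k.+1 -> 'M[R]_n) : Prop :=
  forall x : 'cV[R]_n,
    mxle (mxmin (fun i => M i *m x)) 0 ->
    mxle 0 (mxmax (fun i => M i *m x)) -> x = 0.

(* invmx is total, so invertibility is required explicitly. *)
Definition M_matrix {R : realType} {n : nat} (A : 'M[R]_n) : Prop :=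
  [/\ A \in unitmx, mxle 0 (invmx A) & forall i j, i != j -> A i j <= 0].

Definition comparison_mx {R : realType} {n : nat} (A : 'M[R]_n) : 'M[R]_n :=
  \matrix_(i, j) if i == j then `|A i j| else - `|A i j|.

Definition H_matrix {R : realType} {n : nat} (A : 'M[R]_n) : Prop :=
  M_matrix (comparison_mx A).

Definition Hplus_matrix {R : realType} {n : nat} (A : 'M[R]_n) : Prop :=
  H_matrix A /\ forall i, 0 < A i i.

(* The splitting A = diag_part A - off_part A. *)
Definition diag_part {R : realType} {n : nat} (A : 'M[R]_n) : 'M[R]_n :=
  diag_mx (\row_j A j j).

Definition off_part {R : realType} {n : nat} (A : 'M[R]_n) : 'M[R]_n :=
  diag_part A - A.

Definition max_jacobi {R : realType} {k n : nat} (M : 'I_k.+1 -> 'M[R]_n) :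
    'M[R]_n :=
  mxmax (fun i => invmx (diag_part (M i)) *m mxabs (off_part (M i))).

Definition gamma {R : realType} {k n : nat} (M : 'I_k.+1 -> 'M[R]_n)
    (l : 'I_k.+1) : 'M[R]_n :=
  invmx (1%:M - max_jacobi M) *m invmx (diag_part (M l)).

Definition eta_hat {R : realType} {k n : nat} (M : 'I_k.+1 -> 'M[R]_n)
    (eps : 'I_k.+1 -> R) : R :=
  \sum_(i < k.+1) eps i * opnorm (gamma M i) * opnorm (M i).

(* Main.v *)
Require Import Defs.
From mathcomp Require Import all_boot all_order all_algebra.
From mathcomp Require Import complex ring lra.
From mathcomp Require Import all_classical all_reals all_analysis.

Import Order.TTheory GRing.Theory Num.Theory.
Import numFieldNormedType.Exports.

Set Implicit Arguments.
Unset Strict Implicit.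

Local Open Scope ring_scope.

(** Write B for the entrywise maximum of the Jacobi matrices and L_l for the
    diagonal part of M_l. Both claims come from one estimate,
    [mxabs_le_sum_gamma_mul]. Suppose that in every row a some M_l d is at most
    r_l, and some (possibly other) M_l d is at least - r_l. Dividing such a row
    by its positive diagonal entry isolates d_a, and whichever l occurs, the
    off-diagonal terms are at most (B|d|)_a; hence
    |d| <= B|d| + sum_l L_l^-1 r_l. If I - B reflects nonnegativity, then
    |d| <= (I - B)^-1 sum_l L_l^-1 r_l = sum_l gamma_l r_l.

    For the row W-property, a vector x mixing signs under the perturbed family
    satisfies the hypotheses with d = x and r_l = eps_l |M_l||x|; in norm,
    |x| <= eta_hat |x|, so x = 0. For the error bound, take d = x - y. In a row
    where M_l x + q_l vanishes, the perturbed expression at y is nonnegative,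
    and vice versa, which bounds (M_l d)_a by |dM_l y + dq_l|_a. Since
    M_l x + q_l >= 0 gives (-q_l)_+ <= |M_l||x|, and since |y| <= |x| + |x - y|,
    one may take r_l = eps_l |M_l| (2|x| + |x - y|). The term in 2|x| gives the
    numerator and the term in |x - y| is absorbed by 1 - eta_hat.

    What remains is that rho(B) < 1 makes I - B monotone. This is obtained
    without Perron-Frobenius theory or Neumann series: the intermediate value
    theorem along I - tB, 0 <= t <= 1, produces a positive v with Bv < v
    ([semipositive_of_no_eigenvalue_ge1]), and such a v forces monotonicity
    ([semipositive_monotone]). *)

(** * The spectral radius and monotonicity of I - B *)

(** The eigenvalues are the finitely many roots of the characteristic polynomial,
    so the set whose supremum is taken is bounded, here by the sum of the moduli
    of all the roots. *)
Lemma eigenvalue_le_spectral_radius (R : realType) (n : nat) (A : 'M[R]_n)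
    (t : R) : eigenvalue A t -> `|t| <= spectral_radius A.
Proof.
move=> At; set C := map_mx (real_complex R) A.
have [rs rsE] := closed_field_poly_normal (char_poly C).
apply: ub_le_sup; last first.
  exists (real_complex R t); first by rewrite /= eigenvalue_map.
  by rewrite /= expr0n /= addr0 sqrtr_sqr.
exists (\sum_(z <- rs) ComplexField.Normc.normc z) => _ [z Cz <-].
have zrs : z \in rs.
  by move: Cz; rewrite /= eigenvalue_root_char rsE (monicP (char_poly_monic C))
     scale1r root_prod_XsubC.
rewrite (big_rem z) //= lerDl; apply: sumr_ge0 => i _.
by case: i => a b /=; exact: sqrtr_ge0.
Qed.

Lemma continuous_bigmin_horner (R : realType) (I : Type) (s : seq I)
    (p : I -> {poly R}) (p0 : {poly R}) :
  continuous (fun t => \big[Num.min/p0.[t]]_(i <- s) (p i).[t]).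
Proof.
elim: s => [|i s IHs] t.
  under eq_fun do rewrite big_nil; exact: continuous_horner.
under eq_fun do rewrite big_cons.
by apply: continuous_min; [exact: continuous_horner|exact: IHs].
Qed.

(** Let w(t) = adj(I - tB) 1, so that w(t) = t B w(t) + det(I - tB) 1. The
    determinant has no zero on [0, 1], since a zero at t would make 1/t an
    eigenvalue. The quantities det(I - tB) and w(t)_i are polynomials in t, all
    equal to 1 at t = 0. If their minimum g were not positive at t = 1, it would
    vanish at some t; there w(t) >= 0 and the determinant is positive, so the
    identity makes every w(t)_i positive too, a contradiction. Thus v = w(1)
    works. *)
Lemma semipositive_of_no_eigenvalue_ge1 (R : realType) (n : nat) (B : 'M[R]_n)
    (B_ge0 : forall i j, 0 <= B i j) (B_eig : forall t, 1 <= t -> ~~ eigenvalue B t) :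
  (1%:M - B \in unitmx) /\
  exists v : 'cV[R]_n, forall i, 0 < v i 0 /\ (B *m v) i 0 < v i 0.
Proof.
pose A (t : R) : 'M[R]_n := 1%:M - t *: B.
pose P : 'M[{poly R}]_n := 1%:M - 'X *: map_mx polyC B.
have PE t : map_mx (horner_eval t) P = A t.
  apply/matrixP => i j; rewrite !mxE /horner_eval /= !hornerE.
  by case: (i == j); rewrite /= !hornerE.
pose w t : 'cV[R]_n := \adj (A t) *m const_mx 1.
pose p i : {poly R} := (\adj P *m const_mx 1) i (0 : 'I_1).
have pE t i : (p i).[t] = w t i 0.
  rewrite /w -PE -map_mx_adj /p !mxE -[LHS]/(horner_eval t _) raddf_sum.
  by apply: eq_bigr => j _; rewrite !mxE /= /horner_eval hornerM hornerC.
have dE t : (\det P).[t] = \det (A t).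
  by rewrite -PE det_map_mx.
have Aw t i : w t i 0 = t * (B *m w t) i 0 + \det (A t).
  have : (A t *m w t) i 0 = \det (A t).
    by rewrite /w mulmxA mul_mx_adj mul_scalar_mx !mxE mulr1.
  have subE (a b : 'cV[R]_n) : (a - t *: b) i 0 = a i 0 - t * b i 0.
    by rewrite !mxE.
  by rewrite {1}/A mulmxBl mul1mx -scalemxAl subE => <-; ring.
have A0 : A 0 = 1%:M by rewrite /A scale0r subr0.
have det_neq0 t : 0 <= t <= 1 -> \det (A t) != 0.
  case/andP; rewrite le_eqVlt => /predU1P[<- _|t_gt0 t_le1].
    by rewrite A0 det1 oner_neq0.
  apply/negP => /det0P[u u_neq0]; rewrite /A mulmxBr mulmx1 -scalemxAr.
  move/eqP; rewrite subr_eq0 => /eqP uE.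
  have /negP[] := B_eig t^-1 (ltac:(by rewrite invf_ge1)).
  apply/eigenvalueP; exists u => //.
  by rewrite {2}uE scalerA mulVf ?scale1r // gt_eqF.
pose g t := \big[Num.min/(\det P).[t]]_(i <- index_enum 'I_n) (p i).[t].
have gle t m : m <= g t -> m <= \det (A t) /\ forall i, m <= w t i 0.
  move=> /bigmin_geP[]; rewrite dE => h1 h2; split=> // i.
  by rewrite -pE h2.
have g0 : 0 < g 0.
  apply/bigmin_gtP; split=> [|i _]; first by rewrite dE A0 det1 ltr01.
  by rewrite pE Aw mul0r add0r A0 det1 ltr01.
have g1 : 0 < g 1.
  rewrite ltNge; apply/negP => g1_le0.
  have [] := @IVT _ g 0 1 0 ler01.
  - apply: continuous_subspaceT; exact: continuous_bigmin_horner.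
  - by rewrite ge_min le_max g1_le0 (ltW g0) orbT.
  move=> t; rewrite in_itv /= => t01 g_t_eq0.
  have [det_ge0 w_ge0] : 0 <= \det (A t) /\ forall i, 0 <= w t i 0.
    by apply: gle; rewrite g_t_eq0.
  have det_gt0 : 0 < \det (A t) by rewrite lt_neqAle eq_sym det_neq0.
  suff : 0 < g t by rewrite g_t_eq0 ltxx.
  apply/bigmin_gtP; split=> [|i _]; rewrite ?dE // pE Aw ltr_wpDl //.
  rewrite mulr_ge0 ?(andP t01).1 // mxE; apply: sumr_ge0 => j _.
  exact: mulr_ge0.
(* The positive determinant gives both invertibility and B v < v. *)
have det1_gt0 : 0 < \det (A 1).
  by move/bigmin_gtP: g1 => []; rewrite dE.
have A1 : A 1 = 1%:M - B by rewrite /A scale1r.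
split; first by rewrite -A1 unitmxE unitfE gt_eqF.
exists (w 1) => i; split.
  by move/bigmin_gtP: g1 => [_ /(_ i isT)]; rewrite pE.
by rewrite (Aw 1 i) mul1r ltrDl.
Qed.

(** At an index i where c = x_i / v_i is smallest, x >= c v gives
    c (B v)_i <= (B x)_i <= x_i = c v_i, which is incompatible with c < 0. *)
Lemma semipositive_monotone (R : realType) (n : nat) (B : 'M[R]_n) (v x : 'cV[R]_n)
    (B_ge0 : forall i j, 0 <= B i j)
    (v_semipos : forall i, 0 < v i 0 /\ (B *m v) i 0 < v i 0)
    (Bx_le : forall i, (B *m x) i 0 <= x i 0) :
  forall i, 0 <= x i 0.
Proof.
move=> i0; pose c i := x i 0 / v i 0.
have v_gt0 i : 0 < v i 0 by case: (v_semipos i).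
have [i _ c_min] := @arg_minP _ R _ i0 predT c isT.
suff ci_ge0 : 0 <= c i.
  by have := le_trans ci_ge0 (c_min i0 isT); rewrite /c pmulr_lge0 // invr_gt0.
rewrite leNgt; apply/negP => ci_lt0.
have xcv j : c i * v j 0 <= x j 0.
  by rewrite -ler_pdivlMr //; exact: c_min.
have : c i * (B *m v) i 0 <= (B *m x) i 0.
  rewrite !mxE mulr_sumr; apply: ler_sum => j _.
  by rewrite mulrCA ler_wpM2l.
move/le_trans => /(_ _ (Bx_le i)).
have -> : x i 0 = c i * v i 0 by rewrite /c divfK // gt_eqF.
by rewrite ler_nM2l // leNgt (v_semipos i).2.
Qed.

(** * Row sums and the induced infinity norm *)

Lemma norm_le_cV (R : realType) (n : nat) (x : 'cV[R]_n) (c : R) :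
  0 <= c -> (forall i, `|x i 0| <= c) -> `|x| <= c.
Proof.
move=> c_ge0 xc; rewrite /Num.norm /= mx_normrE; apply: bigmax_le => // -[i j] _ /=.
by rewrite (ord1 j).
Qed.

Lemma norm_ge_cV (R : realType) (n : nat) (x : 'cV[R]_n) (i : 'I_n) :
  `|x i 0| <= `|x|.
Proof.
rewrite [leRHS]/Num.norm /= mx_normrE.
exact: (le_bigmax _ (fun ij : 'I_n * 'I_1 => `|x ij.1 ij.2|) (i, 0)).
Qed.

(** The sign vector of the i-th row lies in the unit ball and turns the i-th
    entry of the product into the absolute row sum. *)
Lemma row_sum_le_opnorm (R : realType) (n : nat) (A : 'M[R]_n) (i : 'I_n) :
  \sum_j `|A i j| <= opnorm A.
Proof.
pose x : 'cV[R]_n := \col_j Num.sg (A i j).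
have x1 : `|x| <= 1.
  by apply: norm_le_cV => // j; rewrite mxE normr_sg; case: eqP.
have -> : \sum_j `|A i j| = (A *m x) i 0.
  by rewrite mxE; apply: eq_bigr => j _; rewrite mxE normrEsg mulrC.
apply: le_trans (ler_norm _) _; apply: le_trans (norm_ge_cV _ _) _.
apply: ub_le_sup; last by exists x.
exists (\sum_a \sum_b `|A a b|) => _ [y /= y1 <-].
apply: norm_le_cV => [|a]; first by do 2![apply: sumr_ge0 => ? _].
rewrite [leRHS](bigD1 a) //= mxE.
apply: ler_wpDr; first by do 2![apply: sumr_ge0 => ? _].
apply: le_trans (ler_norm_sum _ _ _) _; apply: ler_sum => b _.
by rewrite normrM ler_piMr // (le_trans (norm_ge_cV _ _)).
Qed.

Lemma opnorm_ge0 (R : realType) (n : nat) (A : 'M[R]_n) : 0 <= opnorm A.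
Proof.
(* In dimension 0 there is no row to compare with. *)
case: n A => [|n] A.
  rewrite /opnorm le_eqVlt; apply/orP; left; rewrite eq_sym; apply/eqP.
  rewrite (_ : image _ _ = [set 0]%classic) ?sup1 //.
  apply/seteqP; split=> [_ [x _ <-]|_ ->] /=; first by rewrite [_ *m _]flatmx0 normr0.
  by exists 0; rewrite /= ?mulmx0 normr0.
by apply: le_trans (row_sum_le_opnorm A 0); apply: sumr_ge0.
Qed.

(** Comparing A with a second matrix B serves to take B = |A|, whose induced
    norm is then never needed: this is how only ||M_i|| enters eta_hat. *)
Lemma norm_mulmx_le_opnorm (R : realType) (n : nat) (A B : 'M[R]_n) (x : 'cV[R]_n) :
  (forall i j, `|B i j| <= `|A i j|) -> `|B *m x| <= opnorm A * `|x|.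
Proof.
move=> BA; apply: norm_le_cV => [|i]; first by rewrite mulr_ge0 ?opnorm_ge0.
apply: le_trans (_ : (\sum_j `|A i j|) * `|x| <= _); last first.
  by rewrite ler_wpM2r // row_sum_le_opnorm.
rewrite mxE mulr_suml; apply: le_trans (ler_norm_sum _ _ _) _.
apply: ler_sum => j _; rewrite normrM.
by rewrite ler_pM // norm_ge_cV.
Qed.

Lemma norm_mxabs (R : realType) (n : nat) (x : 'cV[R]_n) : `|mxabs x| = `|x|.
Proof.
apply/le_anti/andP; split; apply: norm_le_cV => // i.
  by rewrite mxE normr_id norm_ge_cV.
by rewrite -[leLHS]normr_id; have := norm_ge_cV (mxabs x) i; rewrite mxE.
Qed.

Lemma norm_le_of_mxle (R : realType) (n : nat) (x w : 'cV[R]_n) :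
  mxle (mxabs x) w -> `|x| <= `|w|.
Proof.
move=> xw; apply: norm_le_cV => // i; apply: le_trans (norm_ge_cV w i).
by apply: le_trans (ler_norm _); have := xw i 0; rewrite mxE.
Qed.

(** * Entrywise extrema and the row-wise Jacobi estimate *)

Lemma mxmin_attained (R : realType) (k m n : nat) (A : 'I_k.+1 -> 'M[R]_(m, n)) a b :
  exists i, mxmin A a b = A i a b.
Proof.
rewrite mxE; apply: (big_ind (fun x => exists i, x = A i a b)).
- by exists ord0.
- by move=> _ _ [i ->] [j ->]; case: leP => _; [exists i|exists j].
- by move=> i _; exists i.
Qed.

Lemma mxmax_attained (R : realType) (k m n : nat) (A : 'I_k.+1 -> 'M[R]_(m, n)) a b :
  exists i, mxmax A a b = A i a b.
Proof.
rewrite mxE; apply: (big_ind (fun x => exists i, x = A i a b)).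
- by exists ord0.
- by move=> _ _ [i ->] [j ->]; case: leP => _; [exists j|exists i].
- by move=> i _; exists i.
Qed.

Lemma mxmin_le (R : realType) (k m n : nat) (A : 'I_k.+1 -> 'M[R]_(m, n)) i :
  mxle (mxmin A) (A i).
Proof. by move=> a b; rewrite mxE; exact: bigmin_le. Qed.

Lemma le_mxmax (R : realType) (k m n : nat) (A : 'I_k.+1 -> 'M[R]_(m, n)) i :
  mxle (A i) (mxmax A).
Proof. by move=> a b; rewrite mxE; exact: (le_bigmax _ (fun l => A l a b)). Qed.

Lemma mxle_mulmx (R : realType) (m n p : nat) (A B : 'M[R]_(m, n)) (u w : 'M[R]_(n, p)) :
  mxle (mxabs A) B -> mxle (mxabs u) w -> mxle (mxabs (A *m u)) (B *m w).
Proof.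
move=> AB uw i j; rewrite !mxE; apply: le_trans (ler_norm_sum _ _ _) _.
apply: ler_sum => l _; rewrite normrM; have := AB i l; have := uw l j.
by rewrite !mxE => h1 h2; rewrite ler_pM.
Qed.

Lemma invmx_diag_part_mul (R : realType) (n p : nat) (A : 'M[R]_n) (X : 'M[R]_(n, p))
    (diag_gt0 : forall i, 0 < A i i) i j :
  (invmx (diag_part A) *m X) i j = (A i i)^-1 * X i j.
Proof.
have Du : diag_part A \in unitmx.
  rewrite unitmxE unitfE det_diag; apply/prodf_neq0 => l _.
  by rewrite mxE gt_eqF.
rewrite -[in RHS](mulKVmx Du X) {2}/diag_part mul_diag_mx !mxE mulKf //.
by rewrite gt_eqF.
Qed.

Lemma max_jacobi_ge0 (R : realType) (k n : nat) (M : 'I_k.+1 -> 'M[R]_n)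
    (diag_gt0 : forall i a, 0 < M i a a) a b : 0 <= max_jacobi M a b.
Proof.
apply: le_trans (le_mxmax _ ord0 a b).
by rewrite invmx_diag_part_mul // mxE mulr_ge0 // invr_ge0 ltW.
Qed.

(** The row of M_l d is divided by its diagonal entry; the off-diagonal part is
    then bounded by the maximum over all the members, so that the first term no
    longer depends on which l provides the row. *)
Lemma jacobi_row_le (R : realType) (k n : nat) (M : 'I_k.+1 -> 'M[R]_n)
    (d r : 'cV[R]_n) l a (diag_gt0 : forall i a, 0 < M i a a) :
  (M l *m d) a 0 <= r a 0 ->
  d a 0 <= (max_jacobi M *m mxabs d) a 0 + (invmx (diag_part (M l)) *m r) a 0.
Proof.
move=> Md; set L := invmx (diag_part (M l)).
have -> : d a 0 = (L *m off_part (M l) *m d) a 0 + (L *m (M l *m d)) a 0.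
  have splitE : (off_part (M l) *m d) a 0 + (M l *m d) a 0 = M l a a * d a 0.
    have addE (u w : 'cV[R]_n) : (u + w) a 0 = u a 0 + w a 0 by rewrite mxE.
    by rewrite -addE -mulmxDl subrK mul_diag_mx !mxE.
  rewrite -mulmxA !invmx_diag_part_mul // -mulrDr splitE mulKf //.
  by rewrite gt_eqF.
apply: lerD; last first.
  by rewrite !invmx_diag_part_mul // ler_wpM2l // invr_ge0 ltW.
apply: le_trans (ler_norm _) _.
have := @mxle_mulmx _ _ _ _ (L *m off_part (M l)) (max_jacobi M) d (mxabs d) _ _ a 0.
rewrite [mxabs _ a 0]mxE; apply => // i j.
apply: le_trans (le_mxmax _ l i j).
rewrite [mxabs (L *m _) i j]mxE !invmx_diag_part_mul // normrM.
by rewrite [mxabs _ i j]mxE [`|_^-1|]ger0_norm // invr_ge0 ltW.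
Qed.

(** With s = sum_l L_l^-1 r_l, every l contributes at most s, so the row-wise
    estimates give |d| <= B|d| + s in all rows at once. The vector
    z = sum_l gamma_l r_l solves z = B z + s exactly; subtracting,
    B (z - |d|) <= z - |d|, and monotonicity yields z - |d| >= 0. *)
Lemma mxabs_le_sum_gamma_mul (R : realType) (k n : nat) (M : 'I_k.+1 -> 'M[R]_n)
    (r : 'I_k.+1 -> 'cV[R]_n) (d : 'cV[R]_n)
    (diag_gt0 : forall i a, 0 < M i a a)
    (rho_lt1 : spectral_radius (max_jacobi M) < 1)
    (r_ge0 : forall l, mxle 0 (r l))
    (Md_le : forall a, exists l, (M l *m d) a 0 <= r l a 0)
    (Md_ge : forall a, exists l, - r l a 0 <= (M l *m d) a 0) :
  mxle (mxabs d) (\sum_l gamma M l *m r l).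
Proof.
set B := max_jacobi M.
have B_ge0 : forall a b, 0 <= B a b by exact: max_jacobi_ge0.
have B_eig t : 1 <= t -> ~~ eigenvalue B t.
  move=> t_ge1; apply/negP => /eigenvalue_le_spectral_radius.
  by rewrite leNgt (lt_le_trans rho_lt1) // (le_trans t_ge1) // ler_norm.
have [B_unit [v v_semipos]] := semipositive_of_no_eigenvalue_ge1 B_ge0 B_eig.
pose s := \sum_l invmx (diag_part (M l)) *m r l.
have -> : \sum_l gamma M l *m r l = invmx (1%:M - B) *m s.
  by rewrite /s mulmx_sumr; apply: eq_bigr => l _; rewrite mulmxA.
set z := invmx _ *m s.
have zE : z = B *m z + s.
  have : (1%:M - B) *m z = s by exact: mulKVmx.
  by rewrite mulmxBl mul1mx => <-; rewrite addrC subrK.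
have le_s l a : (invmx (diag_part (M l)) *m r l) a 0 <= s a 0.
  rewrite /s summxE (bigD1 l) //= lerDl; apply: sumr_ge0 => i _.
  rewrite invmx_diag_part_mul // mulr_ge0 ?invr_ge0 ?(ltW (diag_gt0 _ _)) //.
  by have := r_ge0 i a 0; rewrite mxE.
have abs_le a : `|d a 0| <= (B *m mxabs d) a 0 + s a 0.
  rewrite ler_norml lerNl; apply/andP; split.
    have [l Mdl] := Md_ge a; rewrite lerNl in Mdl.
    have := jacobi_row_le diag_gt0 (d := - d) (r := r l) (l := l) (a := a).
    rewrite mulmxN mxE => /(_ Mdl); rewrite mxE.
    have -> : mxabs (- d) = mxabs d by apply/matrixP => i j; rewrite !mxE normrN.
    by move=> /le_trans; apply; rewrite lerD2l.
  have [l Mdl] := Md_le a.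
  by apply: le_trans (jacobi_row_le diag_gt0 Mdl) _; rewrite lerD2l.
have subE (p q : 'cV[R]_n) i : (p - q) i 0 = p i 0 - q i 0 by rewrite !mxE.
suff z_ge i : 0 <= (z - mxabs d) i 0.
  by move=> i j; rewrite (ord1 j) -subr_ge0 -subE z_ge.
apply: (semipositive_monotone B_ge0 v_semipos) => {}i.
rewrite mulmxBr {2}zE; have := abs_le i.
have addE (p q : 'cV[R]_n) : (p + q) i 0 = p i 0 + q i 0 by rewrite !mxE.
rewrite !subE addE [mxabs d i 0]mxE; lra.
Qed.

(** * Norm bounds and the perturbation theorem *)

Lemma norm_sum_gamma_mxabs_le (R : realType) (k n : nat) (M : 'I_k.+1 -> 'M[R]_n)
    (eps : 'I_k.+1 -> R) (eps_ge0 : forall i, 0 <= eps i) (u : 'cV[R]_n) :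
  `|\sum_l gamma M l *m (eps l *: mxabs (M l) *m u)| <=
    (\sum_(i < k.+1) eps i * opnorm (gamma M i *m mxabs (M i))) * `|u|.
Proof.
apply: le_trans (ler_norm_sum _ _ _) _; rewrite mulr_suml; apply: ler_sum => l _.
rewrite -scalemxAl -scalemxAr normrZ ger0_norm // -mulrA ler_wpM2l //.
by rewrite mulmxA; exact: norm_mulmx_le_opnorm.
Qed.

Lemma norm_sum_gamma_mxabs_le_eta_hat (R : realType) (k n : nat)
    (M : 'I_k.+1 -> 'M[R]_n)
    (eps : 'I_k.+1 -> R) (eps_ge0 : forall i, 0 <= eps i) (u : 'cV[R]_n) :
  `|\sum_l gamma M l *m (eps l *: mxabs (M l) *m u)| <= eta_hat M eps * `|u|.
Proof.
apply: le_trans (ler_norm_sum _ _ _) _; rewrite mulr_suml; apply: ler_sum => l _.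
rewrite -scalemxAl -scalemxAr normrZ ger0_norm // -!mulrA ler_wpM2l //.
apply: le_trans (norm_mulmx_le_opnorm _ (fun _ _ => lexx _)) _.
rewrite ler_wpM2l ?opnorm_ge0 //; apply: norm_mulmx_le_opnorm => i j.
by rewrite mxE normr_id.
Qed.

Theorem theorem4p2 (R : realType) (k n : nat)
    (M dM : 'I_k.+1 -> 'M[R]_n) (q dq : 'I_k.+1 -> 'cV[R]_n)
    (eps : 'I_k.+1 -> R)
    (M_W : row_W_property M)
    (eps_ge0 : forall i, 0 <= eps i)
    (dM_le : forall i, mxle (mxabs (dM i)) (eps i *: mxabs (M i)))
    (dq_le : forall i, mxle (mxabs (dq i)) (eps i *: mxabs (mxpos (- q i))))
    (M_Hplus : forall i, Hplus_matrix (M i))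
    (rho_lt1 : spectral_radius (max_jacobi M) < 1)
    (eta_lt1 : eta_hat M eps < 1) :
  row_W_property (fun i => M i + dM i) /\
  (forall x y : 'cV[R]_n,
     evlcp_sol M q x ->
     evlcp_sol (fun i => M i + dM i) (fun i => q i + dq i) y ->
     `|x - y| / `|x| <=
       2 * (\sum_(i < k.+1) eps i * opnorm (gamma M i *m mxabs (M i)))
         / (1 - eta_hat M eps)).
Proof.
have diag_gt0 i a : 0 < M i a a by case: (M_Hplus i).
pose T (l : 'I_k.+1) : 'M[R]_n := eps l *: mxabs (M l).
have addE (u w : 'cV[R]_n) a : (u + w) a 0 = u a 0 + w a 0 by rewrite mxE.
have subE (u w : 'cV[R]_n) a : (u - w) a 0 = u a 0 - w a 0 by rewrite !mxE.
have T_mul_ge0 l (u : 'cV[R]_n) : (forall a, 0 <= u a 0) -> mxle 0 (T l *m u).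
  move=> u_ge0 a b; rewrite (ord1 b) !mxE; apply: sumr_ge0 => j _.
  by rewrite !mxE !mulr_ge0.
have dM_mul l (u : 'cV[R]_n) : mxle (mxabs (dM l *m u)) (T l *m mxabs u) by exact: mxle_mulmx.
split.
  move=> x min_le max_ge.
  have x_le : mxle (mxabs x) (\sum_l gamma M l *m (T l *m mxabs x)).
    apply: mxabs_le_sum_gamma_mul => //.
    - by move=> l; apply: T_mul_ge0 => a; rewrite mxE.
    - move=> a; have [l lE] := mxmin_attained (fun i => (M i + dM i) *m x) a 0.
      exists l; have := min_le a 0; rewrite lE mulmxDl addE [_ 0 a 0]mxE.
      by have := dM_mul l x a 0; rewrite [mxabs _ a 0]mxE ler_norml; lra.
    - move=> a; have [l lE] := mxmax_attained (fun i => (M i + dM i) *m x) a 0.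
      exists l; have := max_ge a 0; rewrite lE mulmxDl addE [_ 0 a 0]mxE.
      by have := dM_mul l x a 0; rewrite [mxabs _ a 0]mxE ler_norml; lra.
  have := norm_sum_gamma_mxabs_le_eta_hat M eps_ge0 (mxabs x).
  move=> /(le_trans (norm_le_of_mxle x_le)); rewrite norm_mxabs.
  rewrite -subr_ge0 -[X in _ - X]mul1r -mulrBl nmulr_rge0 ?subr_lt0 //.
  by rewrite normr_le0 => /eqP.
move=> x y xsol ysol.
have x_ge l a : 0 <= (M l *m x + q l) a 0.
  have := mxmin_le (fun i => M i *m x + q i) l a 0.
  by rewrite xsol [_ 0 a 0]mxE.
have y_ge l a : 0 <= ((M l + dM l) *m y + (q l + dq l)) a 0.
  have := mxmin_le (fun i => (M i + dM i) *m y + (q i + dq i)) l a 0.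
  by rewrite ysol [_ 0 a 0]mxE.
pose u := 2 *: mxabs x + mxabs (x - y).
have dMq_le l a : `|(dM l *m y) a 0 + (dq l) a 0| <= (T l *m u) a 0.
  (* The first summand controls dM_l y, the second dq_l. *)
  have -> : T l *m u = T l *m (mxabs x + mxabs (x - y)) + T l *m mxabs x.
    by rewrite -mulmxDr /u scaler_nat addrAC.
  rewrite addE; apply: le_trans (ler_normD _ _) _; apply: lerD.
    have := @mxle_mulmx _ _ _ _ (dM l) (T l) y (mxabs x + mxabs (x - y)) _ _ a 0.
    rewrite [mxabs _ a 0]mxE; apply => // i j; rewrite !mxE.
    by rewrite -{1}(subKr (x i j) (y i j)) (le_trans (ler_normB _ _)).
  have := dq_le l a 0; rewrite [mxabs _ a 0]mxE => /le_trans; apply.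
  rewrite /T -scalemxAl 2!mxE [leRHS]mxE ler_wpM2l //.
  rewrite ger0_norm; last by rewrite mxE le_max lexx.
  have Mx_le : `|(M l *m x) a 0| <= (mxabs (M l) *m mxabs x) a 0.
    by have := @mxle_mulmx _ _ _ _ (M l) _ x _ (fun _ _ => lexx _) (fun _ _ => lexx _) a 0;
      rewrite [mxabs _ a 0]mxE.
  rewrite mxE ge_max (le_trans _ Mx_le) //= (le_trans _ Mx_le) // mxE.
  by apply: le_trans (ler_norm _); have := x_ge l a; rewrite addE; lra.
have d_le : mxle (mxabs (x - y)) (\sum_l gamma M l *m (T l *m u)).
  apply: mxabs_le_sum_gamma_mul => //.
  - by move=> l; apply: T_mul_ge0 => a; rewrite !mxE addr_ge0 // mulr_ge0.
  - move=> a; have [l lE] := mxmin_attained (fun i => M i *m x + q i) a 0.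
    exists l; have := dMq_le l a; have := y_ge l a; move: lE.
    rewrite xsol [_ 0 a 0]mxE mulmxBr mulmxDl subE !addE ler_norml; lra.
  - move=> a; have [l lE] := mxmin_attained
      (fun i => (M i + dM i) *m y + (q i + dq i)) a 0.
    exists l; have := dMq_le l a; have := x_ge l a; move: lE.
    rewrite ysol [_ 0 a 0]mxE mulmxBr mulmxDl subE !addE ler_norml; lra.
set S := \sum_(i < k.+1) _.
have S_ge0 : 0 <= S by apply: sumr_ge0 => i _; rewrite mulr_ge0 // opnorm_ge0.
have eta_gt0 : 0 < 1 - eta_hat M eps by rewrite subr_gt0.
have bound : (1 - eta_hat M eps) * `|x - y| <= 2 * S * `|x|.
  have := norm_le_of_mxle d_le.
  have -> : \sum_l gamma M l *m (T l *m u) =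
      2 *: (\sum_l gamma M l *m (T l *m mxabs x)) +
      \sum_l gamma M l *m (T l *m mxabs (x - y)).
    rewrite scaler_sumr -big_split /=; apply: eq_bigr => l _.
    by rewrite /u !mulmxDr -!scalemxAr.
  move=> /le_trans => /(_ _ (ler_normD _ _)); rewrite normrZ ger0_norm //.
  have := norm_sum_gamma_mxabs_le M eps_ge0 (mxabs x).
  have := norm_sum_gamma_mxabs_le_eta_hat M eps_ge0 (mxabs (x - y)).
  by rewrite !norm_mxabs -/S /T; lra.
(* For x = 0 the quotient is 0 by the convention 0^-1 = 0. *)
have [->|x_neq0] := eqVneq x 0.
  by rewrite normr0 invr0 mulr0 divr_ge0 ?mulr_ge0 // ltW.
rewrite ler_pdivrMr ?normr_gt0 // mulrAC ler_pdivlMr //.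
by rewrite mulrC.
Qed.
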